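(* Let $\mathcal F$ be a finite, degenerate family of graphs satisfying $\mathrm{ex}(n,\mathcal F)=O(n^{1+\alpha})$ for some constant $\alpha\in[0,1)$, and $\tau(\mathcal F)\ge 2$. Let $p>\frac{1}{1-\alpha}$ be a real number. Then there exists $n_0=n_0(\mathcal F,p)$ such that the following holds for all $n\ge n_0$. If $G$ is an $\mathcal F$-free graph on $n$ vertices with $e_p(G)=\mathrm{ex}_p(n,\mathcal F)$, and $K_{\tau(\mathcal F)-1,\,n-\tau(\mathcal F)+1}$ is a maximal $\mathcal F$-free graph, then $G=K_{\tau(\mathcal F)-1,\,n-\tau(\mathcal F)+1}$.
   Context: All graphs are finite, simple and undirected; subgraphs need not be induced; equality of graphs is up to isomorphism. $K_{a,b}$ is the complete bipartite graph with classes of sizes $a,b$. For a family $\mathcal F$ of graphs, $G$ is $\mathcal F$-free if $G$ contains no $F\in\mathcal F$ as a subgraph. An $\mathcal F$-free graph $H$ is a maximal $\mathcal F$-free graph if adding any new edge (between two non-adjacent vertices of $H$) creates a copy of some $F\in\mathcal F$. $\mathrm{ex}(n,\mathcal F)$ is the maximum number of edges of an $\mathcal F$-free graph on $n$ vertices. For real $p>0$, $e_p(G)=\sum_{v\in V(G)}d_G(v)^p$, and $\mathrm{ex}_p(n,\mathcal F)$ is the maximum of $e_p(G)$ over all $\mathcal F$-free graphs $G$ on $n$ vertices. A family $\mathcal F$ is degenerate if at least one graph in $\mathcal F$ is bipartite. For a bipartite graph $F$, an independent vertex cover of $F$ is an independent set of vertices that meets every edge of $F$, and $\tau(F)$ is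 the minimum size of an independent vertex cover of $F$. For a degenerate family, $\tau(\mathcal F)=\min\{\tau(F):F\in\mathcal F\text{ is bipartite}\}$. *)

(* Defs.v *)
From HB Require Import structures.
From mathcomp Require Import all_boot all_order all_algebra.
From mathcomp Require Import all_classical all_reals all_analysis.

Set Implicit Arguments.
Unset Strict Implicit.
Unset Printing Implicit Defensive.

Import Order.TTheory GRing.Theory Num.Theory.
Import numFieldNormedType.Exports.

Local Open Scope nat_scope.

Record sgraph (T : finType) := SGraph {
  edges : {set {set T}};
  edges_card2 : [forall e in edges, #|e| == 2]
}.

HB.instance Definition _ (T : finType) := [isSub for @edges T].
HB.instance Definition _ (T : finType) := [Finite of sgraph T by <:].

Fact mkgraph_proof (T : finType) (E : {set {set T}}) :
  [forall e in [set e in E | #|e| == 2], #|e| == 2].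
Proof. by apply/forall_inP => e; rewrite inE => /andP[]. Qed.

(* Elements of E that are not 2-element sets are discarded. *)
Definition mkgraph (T : finType) (E : {set {set T}}) : sgraph T :=
  SGraph (mkgraph_proof E).

Definition adj (T : finType) (G : sgraph T) : rel T :=
  fun x y => [set x; y] \in edges G.

Definition degree (T : finType) (G : sgraph T) (v : T) : nat :=
  #|[set w | adj G v w]|.

Definition add_edge (T : finType) (G : sgraph T) (x y : T) : sgraph T :=
  mkgraph ([set x; y] |: edges G).

Definition isomorphic (T U : finType) (G : sgraph T) (H : sgraph U) : Prop :=
  exists2 f : T -> U, bijective f & {mono f : x y / adj G x y >-> adj H x y}.

Definition Kbip (a b : nat) : sgraph ('I_a + 'I_b)%type :=
  mkgraph [set [set inl i; inr j] | i : 'I_a, j : 'I_b].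

(* Subgraph containment, not necessarily induced. *)
Definition contains (T U : finType) (G : sgraph T) (F : sgraph U) : bool :=
  [exists f : {ffun U -> T},
    injectiveb f && [forall x, forall y, adj F x y ==> adj G (f x) (f y)]].

Definition graph_family := seq {U : finType & sgraph U}.

Definition family_free (Fs : graph_family) (T : finType) (G : sgraph T) : bool :=
  all (fun F => ~~ contains G (tagged F)) Fs.

Definition maximal_free (Fs : graph_family) (T : finType) (G : sgraph T) : bool :=
  family_free Fs G &&
  [forall x, forall y,
    (x != y) && ~~ adj G x y ==> ~~ family_free Fs (add_edge G x y)].

(* Every graph on n vertices is isomorphic to one on 'I_n. *)
Definition extremal (n : nat) (Fs : graph_family) : nat :=
  \max_(G : sgraph 'I_n | family_free Fs G) #|edges G|.

Definition degree_power (R : realType) (p : R) (T : finType) (G : sgraph T) : R :=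
  (\sum_(v : T) (degree G v)%:R `^ p)%R.

(* The default value 0 is harmless, as degree_power p G is nonnegative. *)
Definition extremal_p (R : realType) (p : R) (n : nat) (Fs : graph_family) : R :=
  (\big[Num.max/0]_(G : sgraph 'I_n | family_free Fs G) degree_power p G)%R.

Definition bipartite (T : finType) (G : sgraph T) : bool :=
  [exists A : {set T},
    [forall x, forall y, adj G x y ==> ((x \in A) != (y \in A))]].

Definition degenerate (Fs : graph_family) : bool :=
  has (fun F => bipartite (tagged F)) Fs.

Definition independent (T : finType) (G : sgraph T) (S : {set T}) : bool :=
  [forall x in S, forall y in S, ~~ adj G x y].

Definition vertex_cover (T : finType) (G : sgraph T) (S : {set T}) : bool :=
  [forall e in edges G, ~~ [disjoint S & e]].

(* Minimum of a nonempty sequence; 0 on the empty one. *)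
Definition seq_min (s : seq nat) : nat := foldr minn (head 0 s) s.

(* Every bipartite graph has an independent vertex cover (either class), so
   the value 0 of seq_min on [::] plays no role for such graphs. *)
Definition tau (T : finType) (G : sgraph T) : nat :=
  seq_min
    [seq #|A| | A : {set T} in [pred A | independent G A & vertex_cover G A]].

Definition tau_family (Fs : graph_family) : nat :=
  seq_min [seq tau (tagged F) | F <- Fs & bipartite (tagged F)].

(* Main.v *)
Require Import Defs.
From mathcomp Require Import all_boot all_order all_algebra.
From mathcomp Require Import all_classical all_reals all_analysis.
From mathcomp Require Import fintype finset zify ring lra.

(* Put q = 1/(1 - alpha) and s = tau(F) - 1.  Splitting the vertex set into
   blocks of size h and using the edge bound on each block shows that h vertices
   send at most O(n h^alpha) edges, so O((n/x)^q) vertices have degree at least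
   x.  As q < p, a dyadic summation gives e_p <= O(n^p), and the vertices of
   degree at most e n contribute only O(e^(p-q) n^p).  A forbidden bipartite
   graph with an independent cover of size s + 1 bounds the common neighbourhood
   of any s + 1 vertices, so the boundedly many vertices of degree above e n have
   total degree at most s n + O(1); since e_p(G) >= e_p(K_{s,n-s}), there are s
   vertices of almost full degree, forming a set S.  Let W be their common
   neighbourhood and L the rest.  Maximality of K_{s,n-s} makes S and W
   independent, and comparing e_p(G) with e_p(K_{s,n-s}) once more leaves no
   room for a vertex in L. *)

Set Implicit Arguments.
Unset Strict Implicit.
Unset Printing Implicit Defensive.

Import Order.TTheory GRing.Theory Num.Theory.
Import numFieldNormedType.Exports.

Local Open Scope nat_scope.

(** * Graphs, embeddings and degrees *)

Lemma adj_sym (T : finType) (G : sgraph T) : symmetric (adj G).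
Proof. by move=> x y; rewrite /adj setUC. Qed.

Lemma edge_card (T : finType) (G : sgraph T) e : e \in edges G -> #|e| = 2.
Proof. by move=> eG; apply/eqP/(forall_inP (edges_card2 G)). Qed.

Lemma adj_irr (T : finType) (G : sgraph T) : irreflexive (adj G).
Proof.
move=> x; apply/negP => /edge_card.
by rewrite setUid cards1.
Qed.

Lemma adj_neq (T : finType) (G : sgraph T) x y : adj G x y -> x != y.
Proof. by apply: contraTneq => ->; rewrite adj_irr. Qed.

Lemma adj_mkgraph (T : finType) (E : {set {set T}}) x y :
  adj (mkgraph E) x y = ([set x; y] \in E) && (x != y).
Proof. by rewrite /adj /= inE cards2; case: (x =P y). Qed.

Lemma set2_inj (T : finType) (x y x' y' : T) :
  ([set x; y] == [set x'; y']) =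
  ((x == x') && (y == y')) || ((x == y') && (y == x')).
Proof.
apply/eqP/idP; last first.
  by case/orP=> /andP[/eqP-> /eqP->] //; rewrite setUC.
move=> E.
have /set2P Hx : x \in [set x'; y'] by rewrite -E set21.
have /set2P Hy : y \in [set x'; y'] by rewrite -E set22.
have /set2P Hx' : x' \in [set x; y] by rewrite E set21.
have /set2P Hy' : y' \in [set x; y] by rewrite E set22.
case: Hx Hy Hx' Hy' => -> [] -> [] ? [] ?; subst; rewrite ?eqxx ?orbT //.
Qed.

Lemma adj_add_edge (T : finType) (G : sgraph T) x y u v :
  adj (add_edge G x y) u v =
  adj G u v || [&& ([set u; v] == [set x; y]) & u != v].
Proof.
rewrite adj_mkgraph in_setU1 andb_orl orbC; congr (_ || _).
by apply/andb_idr/adj_neq.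
Qed.

Lemma containsP (T U : finType) (G : sgraph T) (F : sgraph U) :
  reflect (exists2 f : U -> T, injective f &
             forall x y, adj F x y -> adj G (f x) (f y))
          (contains G F).
Proof.
apply: (iffP existsP) => [[f /andP[/injectiveP fi /forallP fa]]|[f fi fa]].
  by exists f => // x y; move: (fa x) => /forallP/(_ y)/implyP.
exists (finfun f); apply/andP; split.
  by apply/injectiveP => x y; rewrite !ffunE => /fi.
by apply/forallP => x; apply/forallP => y; apply/implyP; rewrite !ffunE => /fa.
Qed.

(* [{U : finType & sgraph U}] has no [eqType] structure, hence [List.In] *)
Lemma family_freeP (Fs : graph_family) (T : finType) (G : sgraph T) :
  reflect (forall F, List.In F Fs -> ~~ contains G (tagged F))
          (family_free Fs G).
Proof.
elim: Fs => [|F Fs IH] /=; first by left.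
apply: (iffP andP) => [[FG /IH H] F' [<-|/H]|H] //.
by split; [apply: H; left | apply/IH => F' F'Fs; apply: H; right].
Qed.

Lemma contains_embed (T T' : finType) (f : T -> T') (G : sgraph T)
    (G' : sgraph T') (Fs : graph_family) :
  injective f -> (forall x y, adj G x y -> adj G' (f x) (f y)) ->
  family_free Fs G' -> family_free Fs G.
Proof.
move=> fi fa /family_freeP H; apply/family_freeP => F /H.
apply: contraNN => /containsP[g gi ga].
by apply/containsP; exists (f \o g) => [|x y /ga/fa //]; apply: inj_comp.
Qed.

(** For injective [f], this is the subgraph of [G] induced on the image of [f], carried back to
    [U]. *)
Definition pullback (U T : finType) (f : U -> T) (G : sgraph T) : sgraph U :=
  mkgraph [set e : {set U} | f @: e \in edges G].

Lemma adj_pullback (U T : finType) (f : U -> T) (G : sgraph T) x y :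
  adj (pullback f G) x y = adj G (f x) (f y).
Proof.
rewrite adj_mkgraph inE imsetU !imset_set1 -/(adj G _ _).
by apply/andb_idr => /adj_neq; apply: contraNneq => ->.
Qed.

Lemma pullback_free (U T : finType) (f : U -> T) (G : sgraph T) Fs :
  injective f -> family_free Fs G -> family_free Fs (pullback f G).
Proof. by move=> fi; apply: (contains_embed fi) => x y; rewrite adj_pullback. Qed.

Definition degree_in (T : finType) (G : sgraph T) (v : T) (X : {set T}) : nat :=
  #|[set w in X | adj G v w]|.

Lemma degree_inT (T : finType) (G : sgraph T) v :
  degree G v = degree_in G v [set: T].
Proof. by congr #|pred_of_set _|; apply/setP => w; rewrite !inE. Qed.

Lemma degree_inE (T : finType) (G : sgraph T) v (X : {set T}) :
  degree_in G v X = \sum_(w in X) (adj G v w : nat).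
Proof.
rewrite /degree_in -sum1_card big_mkcond [RHS]big_mkcond; apply: eq_bigr => w _.
by rewrite inE; case: (w \in X); case: (adj _ _ _).
Qed.

Lemma degree_in_exchange (T : finType) (G : sgraph T) (A B : {set T}) :
  \sum_(v in A) degree_in G v B = \sum_(w in B) degree_in G w A.
Proof.
under eq_bigr do rewrite degree_inE; rewrite exchange_big /=.
by apply: eq_bigr => w _; rewrite degree_inE; apply: eq_bigr => v _; rewrite adj_sym.
Qed.

Lemma degree_in_card (T : finType) (G : sgraph T) v (X : {set T}) :
  degree_in G v X <= #|X|.
Proof. by apply/subset_leq_card/subsetP => w; rewrite inE => /andP[]. Qed.

Lemma degree_leq (T : finType) (G : sgraph T) v : degree G v <= #|T|.
Proof. by rewrite degree_inT (leq_trans (degree_in_card _ _ _)) // cardsT. Qed.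

Lemma degree_in_setID (T : finType) (G : sgraph T) v (X Y : {set T}) :
  degree_in G v X = degree_in G v (X :&: Y) + degree_in G v (X :\: Y).
Proof. by rewrite !degree_inE (big_setID Y). Qed.

Lemma sum_degree_leq (T : finType) (G : sgraph T) :
  \sum_v degree G v <= 2 * #|edges G|.
Proof.
have H v : degree G v <= \sum_(e in edges G) (v \in e : nat).
  rewrite /degree -(card_imset _ (f := fun w => [set v; w])); last first.
    move=> w w' /eqP; rewrite set2_inj eqxx /=.
    by case/orP=> [/eqP//|/andP[/eqP-> /eqP->]].
  rewrite -big_mkcondr /= sum1_card; apply/subset_leq_card/subsetP => e.
  by case/imsetP => w; rewrite inE => vw ->; apply/andP; rewrite set21.
apply: (@leq_trans (\sum_v \sum_(e in edges G) (v \in e))); first exact: leq_sum.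
rewrite exchange_big /= -sum1_card big_distrr /=; apply: leq_sum => e eG.
by rewrite -big_mkcond /= sum1_card (edge_card eG).
Qed.

(** * Injections with prescribed targets *)

Lemma inj_into (U T : finType) (W : {set T}) : #|U| <= #|W| ->
  exists2 g : U -> T, injective g & forall u, g u \in W.
Proof.
move=> UW; exists (fun u => enum_val (widen_ord UW (enum_rank u))).
  by move=> u v /enum_val_inj/(congr1 val)/= H; apply/enum_rank_inj/val_inj.
by move=> u; apply: enum_valP.
Qed.

(** Serves to re-embed a forbidden graph: vertices placed in [Z] stay, the others move into [W]. No
    collision arises because [W] avoids [Z]. *)
Lemma inj_redirect (U T : finType) (f : U -> T) (Z W : {set T}) :
  injective f -> #|U| <= #|W| -> [disjoint Z & W] ->
  exists2 g : U -> T, injective g &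
    forall u, if f u \in Z then g u = f u else g u \in W.
Proof.
move=> fi /inj_into[h hi hW] ZW.
exists (fun u => if f u \in Z then f u else h u) => [u v|u]; last first.
  by case: ifP => // ->.
have ZWF x : x \in Z -> x \in W -> False.
  by move=> xZ xW; move: (disjointFr ZW xZ); rewrite xW.
case: ifP => uZ; case: ifP => vZ E.
- exact: fi.
- by case: (ZWF _ uZ); rewrite E.
- by case: (ZWF _ vZ); rewrite -E.
- exact: hi.
Qed.

Lemma inj_bipartition (U T : finType) (A : {set U}) (S W : {set T}) :
  0 < #|A| -> #|A| <= #|S| -> #|U| <= #|W| -> [disjoint S & W] ->
  exists2 f : U -> T, injective f &
    forall u, if u \in A then f u \in S else f u \in W.
Proof.
case/card_gt0P=> a aA AS /inj_into[h hi hW] SW.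
pose f u := if u \in A then enum_val (widen_ord AS (enum_rank_in aA u)) else h u.
have fP u : if u \in A then f u \in S else f u \in W.
  by rewrite /f; case: ifP => uA; rewrite ?uA ?enum_valP ?hW.
have SWF x : x \in S -> x \in W -> False.
  by move=> xS xW; move: (disjointFr SW xS); rewrite xW.
exists f => // u v E; move: (fP u) (fP v).
case: ifP => uA; case: ifP => vA; rewrite E => fu fv.
- move: E; rewrite /f uA vA => /enum_val_inj/(congr1 val)/= H.
  rewrite -(enum_rankK_in aA uA) -(enum_rankK_in aA vA); congr enum_val.
  exact: val_inj.
- by case: (SWF _ fu fv).
- by case: (SWF _ fv fu).
by move: E; rewrite /f uA vA => /hi.
Qed.

(** Positivity excludes the default value 0 of the empty sequence, so the minimum is attained. *)
Lemma seq_min_mem (s : seq nat) : 0 < seq_min s -> seq_min s \in s.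
Proof.
have foldP x r : foldr minn x r \in x :: r.
  elim: r x => [|y r IH] x; first by rewrite inE.
  have := IH x; rewrite /= !inE /minn; case: ifP => _; first by rewrite eqxx orbT.
  by case/orP=> ->; rewrite ?orbT.
case: s => [|x s] // _; have := foldP x (x :: s).
by rewrite inE => /orP[/eqP E|//]; rewrite /seq_min [head _ _]/= E mem_head.
Qed.

Lemma tau_familyP (Fs : graph_family) : 0 < tau_family Fs ->
  exists2 F, List.In F Fs & exists A : {set tag F},
    [/\ #|A| = tau_family Fs, independent (tagged F) A
      & vertex_cover (tagged F) A].
Proof.
move=> t0; have := seq_min_mem t0; rewrite -/(tau_family Fs).
have H (t : nat) : t \in [seq tau (tagged F) | F <- Fs & bipartite (tagged F)] ->
    exists2 F, List.In F Fs & tau (tagged F) = t.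
  elim: Fs {t0} => [|F Fs IH] //=.
  case: (bipartite _); last by case/IH => F' ? ?; exists F' => //; right.
  rewrite inE => /orP[/eqP->|/IH[F' ? ?]]; first by exists F => //; left.
  by exists F' => //; right.
case/H=> F FFs tF; exists F => //.
have tF0 : 0 < tau (tagged F) by rewrite tF.
have /imageP[A] := seq_min_mem tF0.
rewrite inE => /andP[iA vA] E; exists A; split=> //.
by rewrite -tF /tau E.
Qed.

(** * Common neighbourhoods and the graph K_{a,b} *)

Definition common_nbrs (T : finType) (G : sgraph T) (S : {set T}) : {set T} :=
  [set w | [forall v in S, adj G v w]].

Lemma common_nbrsP (T : finType) (G : sgraph T) (S : {set T}) w :
  reflect {in S, forall v, adj G v w} (w \in common_nbrs G S).
Proof. by rewrite inE; apply: forall_inP. Qed.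

Lemma common_nbrs_notin (T : finType) (G : sgraph T) (S : {set T}) w :
  w \in common_nbrs G S -> w \notin S.
Proof. by move/common_nbrsP => H; apply/negP => /H; rewrite adj_irr. Qed.

(** Take a member [F] with an independent cover [A] of size [tau_family Fs]. If [S] had [#|tag F|]
    or more common neighbours, [A] could be placed in [S] and the rest of [F] among them; every edge
    of [F] has exactly one end in [A], so this would be a copy of [F]. *)
Lemma common_nbrs_bounded (Fs : graph_family) : 0 < tau_family Fs ->
  exists b : nat, forall (T : finType) (G : sgraph T) (S : {set T}),
    family_free Fs G -> tau_family Fs <= #|S| -> #|common_nbrs G S| <= b.
Proof.
move=> t0; have [F FFs [A [cA iA vA]]] := tau_familyP t0.
exists #|tag F| => T G S /family_freeP/(_ F FFs) nF tS.
rewrite leqNgt; apply: contra nF => /ltnW bW.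
have SW : [disjoint S & common_nbrs G S].
  rewrite disjoint_sym disjoints_subset; apply/subsetP => w /common_nbrs_notin.
  by rewrite inE.
rewrite -cA in t0 tS; have [f fi fP] := inj_bipartition t0 tS bW SW.
apply/containsP; exists f => // x y xy.
have := forall_inP vA _ xy; move: (fP x) (fP y).
case: ifP => xA; case: ifP => yA fx fy.
- by move/forall_inP/(_ x xA)/forall_inP/(_ y yA): iA; rewrite xy.
- by move=> _; apply: (common_nbrsP _ _ _ fy).
- by move=> _; rewrite adj_sym; apply: (common_nbrsP _ _ _ fx).
case/negP; rewrite disjoint_sym disjoints_subset; apply/subsetP => u.
by case/set2P=> ->; rewrite inE ?xA ?yA.
Qed.

(** Count the edges at [H] from their other ends [w]. Each [w] contributes at most [t], except those
    in [B] with more than [t] neighbours in [H]. Vertices of [B] with the same trace [X] on [H] are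
    common neighbours of [X], so each of the [2 ^ #|H|] traces accounts for at most [b] of them. *)
Lemma sum_degree_high (T : finType) (G : sgraph T) (H : {set T}) (t b : nat) :
  (forall S : {set T}, t < #|S| -> #|common_nbrs G S| <= b) ->
  \sum_(v in H) degree G v <= t * #|T| + #|H| * (2 ^ #|H| * b).
Proof.
move=> Hb.
under eq_bigr do rewrite degree_inT.
rewrite degree_in_exchange (eq_bigl xpredT) => [|w]; last by rewrite inE.
pose N w := [set v in H | adj G w v].
pose B := [set w | t < #|N w|].
have cB : #|B| <= 2 ^ #|H| * b.
  rewrite -card_powerset -sum1_card.
  rewrite (partition_big N (fun X => X \in powerset H)) /=; last first.
    by move=> w _; rewrite powersetE; apply/subsetP => v; rewrite inE => /andP[].
  rewrite -sum_nat_const; apply: leq_sum => X _; rewrite sum1_card.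
  (* Only a trace that occurs is known to have more than [t] elements; the class of any other trace
     is empty. *)
  case: (pickP [pred i | (i \in B) && (N i == X)]) => [w /andP[wB /eqP wX]|e0];
    last by rewrite (eq_card0 e0).
  have tX : t < #|X| by rewrite -wX; move: wB; rewrite inE.
  apply: leq_trans (Hb X tX); apply/subset_leq_card/subsetP => u /andP[_ /eqP uX].
  by apply/common_nbrsP => v; rewrite -uX inE => /andP[_]; rewrite adj_sym.
apply: (@leq_trans (\sum_(w : T) (t + #|H| * (w \in B)))).
  apply: leq_sum => w _; rewrite -[degree_in _ _ _]/#|N w|.
  have [wB|] := boolP (w \in B).
    by rewrite muln1 (leq_trans (degree_in_card _ _ _)) ?leq_addl.
  by rewrite inE -leqNgt muln0 addn0.
rewrite big_split /= sum_nat_const mulnC leq_add2l -big_distrr /=.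
by rewrite -big_mkcond /= sum1_card leq_mul2l cB orbT.
Qed.

Lemma adj_Kbip a b (x y : 'I_a + 'I_b) :
  adj (Kbip a b) x y = (is_inl x != is_inl y).
Proof.
rewrite adj_mkgraph; apply/andP/idP => [[/imset2P[i j _ _ /eqP]]|].
  by rewrite set2_inj => /orP[]/andP[/eqP-> /eqP->].
case: x y => [i|i] [j|j] //= _; split=> //; apply/imset2P.
  by exists i j.
by exists j i => //; rewrite setUC.
Qed.

Lemma Kbip_bij (T : finType) (S : {set T}) a b :
  #|S| = a -> #|T| = (a + b)%N ->
  exists2 f : 'I_a + 'I_b -> T, bijective f & forall x, (f x \in S) = is_inl x.
Proof.
move=> cS cT; have cS' : #|~: S| = b by have := cardsC S; rewrite cS cT; lia.
pose f (x : 'I_a + 'I_b) := match x with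
  | inl i => enum_val (cast_ord (esym cS) i)
  | inr j => enum_val (cast_ord (esym cS') j) end.
have fP x : (f x \in S) = is_inl x.
  case: x => i; first by rewrite enum_valP.
  by have := enum_valP (cast_ord (esym cS') i); rewrite inE => /negbTE.
exists f => //; apply: inj_card_bij; last by rewrite card_sum !card_ord cT.
move=> x y E; have := fP x; rewrite E fP.
by case: x y E => [i|i] [j|j] //= /enum_val_inj/cast_ord_inj->.
Qed.

Lemma Kbip_iso (T : finType) (G : sgraph T) (S : {set T}) a b :
  #|S| = a -> #|T| = (a + b)%N ->
  (forall x y, adj G x y = ((x \in S) != (y \in S))) ->
  isomorphic G (Kbip a b).
Proof.
move=> cS cT GS; have [f [g fg gf] fP] := Kbip_bij cS cT.
exists g => [|x y]; first by exists f.
by rewrite adj_Kbip GS -!fP !gf.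
Qed.

(** A crude bound on the order of every member of the family. *)
Definition family_order (Fs : graph_family) : nat := \sum_(F <- Fs) #|tag F|.

Lemma family_order_max (Fs : graph_family) F :
  List.In F Fs -> #|tag F| <= family_order Fs.
Proof.
rewrite /family_order; elim: Fs => [|F' Fs IH] //=.
rewrite big_cons => -[->|/IH H]; first exact: leq_addr.
by rewrite (leq_trans H) ?leq_addl.
Qed.

(* A forbidden graph in K_{a,b} plus an edge has few vertices, so those off S
   and off the extra edge can be moved into the common neighbourhood of S. *)
Lemma maximal_Kbip_sides (Fs : graph_family) (T : finType) (G : sgraph T)
    (S : {set T}) a b x y :
  maximal_free Fs (Kbip a b) -> family_free Fs G ->
  #|S| = a -> #|T| = (a + b)%N ->
  family_order Fs + 2 <= #|common_nbrs G S| ->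
  x \in S :|: common_nbrs G S -> y \in S :|: common_nbrs G S ->
  adj G x y -> (x \in S) != (y \in S).
Proof.
set W := common_nbrs G S => /andP[_ mx] freeG cS cT cW xSW ySW xy.
have [f fb fP] := Kbip_bij cS cT; have [g fg gf] := fb.
apply/negP => /eqP xyS.
(* If [x] and [y] lay on the same side, their copies in K_{a,b} would be non-adjacent, so joining
   them would create a forbidden [F]. It remains to turn that copy into one inside [G]. *)
have := forallP (forallP mx (g x)) (g y); rewrite adj_Kbip -!fP !gf xyS eqxx /=.
rewrite andbT (inj_eq (can_inj gf)) (adj_neq xy) /= => /negP[].
apply/family_freeP => F FFs; apply/negP => /containsP[h hi ha].
have /negP := family_freeP _ _ freeG F FFs; apply; apply/containsP.
pose Z := S :|: [set x; y].
have ZW : [disjoint Z & W :\: [set x; y]].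
  rewrite disjoints_subset; apply/subsetP => v.
  rewrite in_setU in_setC in_setD; case/orP=> [vS|->//].
  by apply: contraL vS => /andP[_ /common_nbrs_notin].
have szW : #|tag F| <= #|W :\: [set x; y]|.
  have := cardsID [set x; y] W; have := family_order_max FFs.
  have : #|W :&: [set x; y]| <= 2.
    by rewrite (leq_trans (subset_leq_card (subsetIr _ _))) // cards2; case: (_ != _).
  lia.
have [k ki kP] := inj_redirect (inj_comp (bij_inj fb) hi) szW ZW.
exists k => // u v uv; have := kP u; have := kP v; have := ha u v uv.
rewrite adj_add_edge adj_Kbip -!fP set2_inj -!(can2_eq fg gf).
have kS w : f (h w) \in S -> k w = f (h w).
  by move=> H; have := kP w; rewrite /= in_setU H.
have kxy w : f (h w) \in [set x; y] -> k w = f (h w).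
  by move=> H; have := kP w; rewrite /= in_setU H orbT.
(* A vertex off [S] either was moved into [W] or is [x] or [y], which then lies in [W] by
   assumption. *)
have kW w : f (h w) \notin S -> k w \in W.
  move=> nS; have := kP w; rewrite /= in_setU in_setD (negbTE nS) /=.
  case: ifP => [/set2P[] E ->|_ /andP[_ //]]; rewrite E in nS *.
    by move: xSW; rewrite in_setU (negbTE nS).
  by move: ySW; rewrite in_setU (negbTE nS).
have mixed w w' : f (h w) \in S -> f (h w') \notin S -> adj G (k w) (k w').
  by move=> wS /kW/common_nbrsP; rewrite (kS _ wS); apply.
case/orP=> [|/andP[/orP[] /andP[/eqP E /eqP E'] _ _ _]].
- case uS: (f (h u) \in S); case vS: (f (h v) \in S) => //= _ _ _.
    by apply: mixed; rewrite ?vS.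
  by rewrite adj_sym; apply: mixed; rewrite ?uS.
- by rewrite !kxy ?E ?E' ?gf ?set21 ?set22.
by rewrite !kxy ?E ?E' ?gf ?set21 ?set22 1?adj_sym.
Qed.

(** * Extremal numbers *)

(** The vertex type is an ordinal because [extremal] and [extremal_p] range over graphs on
    ['I_n]. *)
Definition induced_graph (T : finType) (G : sgraph T) (X : {set T}) : sgraph 'I_#|X| :=
  pullback enum_val G.

Lemma induced_free (T : finType) (G : sgraph T) (X : {set T}) Fs :
  family_free Fs G -> family_free Fs (induced_graph G X).
Proof. exact/pullback_free/enum_val_inj. Qed.

Lemma degree_induced (T : finType) (G : sgraph T) (X : {set T}) i :
  degree (induced_graph G X) i = degree_in G (enum_val i) X.
Proof.
rewrite /degree -(card_imset _ (@enum_val_inj _ (mem X))) /degree_in.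
congr #|pred_of_set _|; apply/setP => w; rewrite inE.
apply/imsetP/andP => [[x + ->]|[wX Gw]].
  by rewrite inE adj_pullback enum_valP.
by exists (enum_rank_in wX w); rewrite ?inE ?adj_pullback enum_rankK_in.
Qed.

Lemma sum_degree_in_extremal (Fs : graph_family) (T : finType) (G : sgraph T)
    (X : {set T}) : family_free Fs G ->
  \sum_(v in X) degree_in G v X <= 2 * extremal #|X| Fs.
Proof.
move=> freeG; rewrite big_enum_val /=.
under eq_bigr do rewrite -degree_induced.
apply: leq_trans (sum_degree_leq _) _; rewrite leq_pmul2l //.
exact: (@leq_bigmax_cond _ (fun G => family_free Fs G) (fun G => #|edges G|) _
  (induced_free X freeG)).
Qed.

Lemma degree_power_in (R : realType) (p : R) (T : finType) (G : sgraph T)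
    (X : {set T}) :
  (\sum_(v in X) (degree_in G v X)%:R `^ p)%R = degree_power p (induced_graph G X).
Proof. by rewrite big_enum_val; apply: eq_bigr => i _; rewrite degree_induced. Qed.

Lemma degree_power_extremal_p (R : realType) (p : R) (Fs : graph_family)
    (T : finType) (G : sgraph T) :
  family_free Fs G -> (degree_power p G <= extremal_p p #|T| Fs)%R.
Proof.
move=> /(induced_free [set: T]) freeG; rewrite -(cardsT T).
have -> : degree_power p G = degree_power p (induced_graph G [set: T]).
  rewrite -degree_power_in; apply: eq_big => [v|v _]; first by rewrite inE.
  by rewrite degree_inT.
exact: (@le_bigmax_cond _ _ _ _ _ _ (fun G => degree_power p G) freeG).
Qed.

Lemma subset_of_card (T : finType) (X : {set T}) n :
  n <= #|X| -> exists2 Y : {set T}, Y \subset X & #|Y| = n.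
Proof.
case/card_geqP=> s [us <- sX]; exists [set x in s].
  by apply/subsetP => x; rewrite inE => /sX.
by rewrite cardsE; apply/card_uniqP.
Qed.

(* Cut X into k blocks of size at most #|H|: each contributes at most the
   degree sum of an induced subgraph on at most 2 #|H| vertices. *)
Lemma sum_degree_in_blocks (T : finType) (G : sgraph T) (H X : {set T}) k M :
  (forall Y : {set T}, #|Y| <= 2 * #|H| -> \sum_(v in Y) degree_in G v Y <= M) ->
  #|X| <= k * #|H| ->
  \sum_(v in H) degree_in G v X <= k * M.
Proof.
move=> HM; elim: k X => [|k IH] X cX.
  rewrite big1 // => v _; apply/eqP.
  by rewrite -leqn0 (leq_trans (degree_in_card _ _ _)).
have [Y YX cY] := subset_of_card (geq_minr #|H| #|X|).
rewrite (eq_bigr (fun v => degree_in G v Y + degree_in G v (X :\: Y))); last first.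
  by move=> v _; rewrite (degree_in_setID G v X Y) (setIidPr YX).
rewrite big_split /= mulSn leq_add //; last first.
  by apply: IH; rewrite cardsD (setIidPr YX) cY; lia.
apply: leq_trans (HM (H :|: Y) _); last first.
  by apply: leq_trans (leq_card_setU _ _) _; rewrite cY; lia.
rewrite [leqRHS](bigID (fun v => v \in H)) /= -[leqLHS]addn0 leq_add //.
rewrite [leqRHS](eq_bigl (fun v => v \in H)); last first.
  by move=> v; rewrite in_setU; case: (v \in H); rewrite ?andbF //.
apply: leq_sum => v _; apply/subset_leq_card/subsetP => w.
by rewrite !inE => /andP[-> ->]; rewrite orbT.
Qed.

Local Open Scope ring_scope.

Lemma extremal_bigO (R : realType) (Fs : graph_family) (a : R) :
  ((fun n : nat => (extremal n Fs)%:R : R^o)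
     =O_\oo (fun n : nat => n%:R `^ a : R^o))%classic -> 0 <= a ->
  exists2 C : R, 0 < C &
    forall n, (0 < n)%N -> (extremal n Fs)%:R <= C * n%:R `^ a.
Proof.
move=> /eqO_exP[k k0 [N _ HN]] a0.
exists (k + \sum_(i < N) (extremal i Fs)%:R).
  by rewrite ltr_wpDr ?sumr_ge0.
move=> n n0; have na : 1 <= n%:R `^ a :> R.
  by rewrite -[leLHS](powRr0 n%:R); apply: ler_powR; rewrite ?ler1n.
have S0 : 0 <= \sum_(i < N) (extremal i Fs)%:R :> R by rewrite sumr_ge0.
have [Nn|nN] := leqP N n.
  have := HN n Nn; rewrite /= !ger0_norm ?powR_ge0 // => /le_trans; apply.
  by rewrite ler_wpM2r ?powR_ge0 // lerDl.
have : (extremal n Fs)%:R <= \sum_(i < N) (extremal i Fs)%:R :> R.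
  by rewrite (bigD1 (Ordinal nN)) //= lerDl sumr_ge0.
move=> /le_trans; apply; rewrite -[leLHS]mulr1 ler_pM // lerDr.
exact: ltW.
Qed.

(** * Degree power sums *)

Lemma powR_le (R : realType) (r x y : R) : 0 <= r -> 0 <= x -> x <= y ->
  x `^ r <= y `^ r.
Proof.
by move=> r0 x0 xy; apply: ge0_ler_powR; rewrite ?nnegrE // (le_trans x0).
Qed.

Lemma powR_lt1 (R : realType) (x r : R) : 0 <= x < 1 -> 0 < r -> x `^ r < 1.
Proof.
move=> /andP[x0 x1] r0.
by have := gt0_ltr_powR r0 x0 ler01 x1; rewrite powR1.
Qed.

Lemma powRDp (R : realType) (x r s : R) : 0 < x -> x `^ (r + s) = x `^ r * x `^ s.
Proof. by move=> x0; rewrite powRD // (gt_eqF x0) implybT. Qed.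

(** With [h] vertices of degree at least [x] and [m] vertices in all, about m/h blocks of size [h]
    give h x <= 16 C m h^a. Cancelling h^a and taking the power 1/(1-a) bounds [h]. *)
Lemma high_degree_count (R : realType) (Fs : graph_family) (a C : R) :
  0 <= a < 1 -> 0 < C ->
  (forall n, (0 < n)%N -> (extremal n Fs)%:R <= C * n%:R `^ (1 + a)) ->
  forall (T : finType) (G : sgraph T) (x : R), family_free Fs G -> 0 < x ->
  #|[set v | x <= (degree G v)%:R]|%:R <= (16 * C * #|T|%:R / x) `^ (1 - a)^-1.
Proof.
move=> /andP[a0 a1] C0 exC T G x freeG x0.
set H := [set v | _]; set h := #|H|; set m := #|T|.
have [->|h0] := posnP h; first exact: powR_ge0.
have hR : 0 < h%:R :> R by rewrite ltr0n.
have hm : (h <= m)%N by rewrite max_card.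
pose Mr : R := 2 * (C * (2 * h%:R) `^ (1 + a)).
have Mr0 : 0 <= Mr by rewrite !mulr_ge0 ?powR_ge0 // ltW.
have HM (Y : {set T}) : (#|Y| <= 2 * h)%N ->
    (\sum_(v in Y) degree_in G v Y <= Num.truncn Mr)%N.
  move=> Y2h; have [/cards0_eq->|Y0] := posnP #|Y|; first by rewrite big_set0.
  rewrite truncn_ge_nat //; apply: (@le_trans _ _ (2 * extremal #|Y| Fs)%:R).
    by rewrite ler_nat sum_degree_in_extremal.
  rewrite natrM ler_pM2l //.
  apply: le_trans (exC _ Y0) _; rewrite ler_pM2l // powR_le ?addr_ge0 //.
  by rewrite -natrM ler_nat.
have Hk : (#|[set: T]| <= (m %/ h).+1 * #|H|)%N.
  by rewrite cardsT ltnW // ltn_ceil.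
have := sum_degree_in_blocks HM Hk.
rewrite -(ler_nat R) natrM.
(* The constant 16 is the product of the 2 found here, from [h <= m], and the 8 of the next bound,
   from [2 * 2 ^ (1 + a) <= 8]. *)
have k2 : (m %/ h).+1%:R <= 2 * m%:R / h%:R :> R.
  rewrite ler_pdivlMr // -natrM -natrM ler_nat mulSn.
  have := leq_trunc_div m h; lia.
have M8 : (Num.truncn Mr)%:R <= 8 * C * h%:R * h%:R `^ a.
  apply: (@le_trans _ _ Mr); first by rewrite -truncn_ge_nat.
  rewrite /Mr powRM ?ler0n // (powRDp _ _ hR) powRr1 ?ler0n //.
  have : 2 `^ (1 + a) <= 4 :> R.
    have -> : 4 = 2 `^ 2%:R :> R by rewrite powR_mulrn // -natrX.
    by apply: ler_powR; rewrite ?ler1n //; lra.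
  move=> h4.
  have ha0 : 0 <= 2 * C * (h%:R * h%:R `^ a) :> R.
    by rewrite !mulr_ge0 ?powR_ge0 // ltW.
  have := ler_wpM2l ha0 h4; lra.
have hx : h%:R * x <= (\sum_(v in H) degree_in G v [set: T])%:R.
  rewrite natr_sum mulrC mulr_natr -sumr_const; apply: ler_sum => v.
  by rewrite inE degree_inT.
move=> hsum; have {hsum} := le_trans hx hsum => hsum.
have {hsum} : h%:R * x <= 16 * C * m%:R * h%:R `^ a.
  apply: le_trans hsum _.
  apply: (@le_trans _ _ ((2 * m%:R / h%:R) * (8 * C * h%:R * h%:R `^ a))).
    by rewrite ler_pM.
  rewrite [leLHS](_ : _ = 16 * C * m%:R * h%:R `^ a) //.
  by field; rewrite gt_eqF.
have ha0 : 0 < h%:R `^ a :> R by rewrite powR_gt0.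
have hE : h%:R = h%:R `^ (1 - a) * h%:R `^ a :> R.
  by rewrite -powRDp // subrK powRr1 // ltW.
rewrite {1}hE mulrAC ler_pM2r // -ler_pdivlMr // => Hh.
have q0 : 0 < 1 - a by rewrite subr_gt0.
have -> : h%:R = (h%:R `^ (1 - a)) `^ (1 - a)^-1 :> R.
  by rewrite -powRrM mulfV ?lt0r_neq0 // powRr1 // ltW.
by apply: powR_le; rewrite ?powR_ge0 // invr_ge0 ltW.
Qed.

(** At most A (2 |T|/y)^q vertices have degree in (y/2, y], each contributing at most y^p. Since q <
    p, repeated halving of [y] yields a geometric series of ratio [c]. *)
Lemma low_degree_power (R : realType) (Fs : graph_family) (q p A : R) :
  0 <= A -> q < p -> 0 < p ->
  (forall (T : finType) (G : sgraph T) (x : R), family_free Fs G -> 0 < x ->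
    #|[set v | x <= (degree G v)%:R]|%:R <= A * (#|T|%:R / x) `^ q) ->
  exists2 K : R, 0 <= K &
    forall (T : finType) (G : sgraph T) (y : R), family_free Fs G -> 0 < y ->
    \sum_(v | (degree G v)%:R <= y) (degree G v)%:R `^ p
      <= K * #|T|%:R `^ q * y `^ (p - q).
Proof.
move=> A0 qp p0 HA; pose c : R := 2^-1 `^ (p - q).
have r0 : 0 < p - q by rewrite subr_gt0.
have c1 : c < 1 by apply: powR_lt1 => //; apply/andP; split; lra.
have c0 : 0 <= c by apply: powR_ge0.
pose B : R := A * 2 `^ q.
have B0 : 0 <= B by rewrite mulr_ge0 ?powR_ge0.
pose K := B / (1 - c).
(* The fixed-point equation that makes the induction close: [K * c] pays for degrees up to y/2, [B]
   for the rest. *)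
have KE : K * c + B = K by rewrite /K; field; rewrite subr_eq0 gt_eqF.
have K0 : 0 <= K by rewrite divr_ge0 // subr_ge0 ltW.
clearbody K; exists K => // T G y freeG y0.
have [k yk] : exists k, y < 2 ^+ k.
  exists (Num.truncn y).+1; apply: lt_trans (truncnS_gt y) _.
  by rewrite -natrX ltr_nat ltn_expl.
elim: k y y0 yk => [|k IH] y y0 yk.
  (* Here [y < 1], so only isolated vertices occur. *)
  rewrite big1 ?mulr_ge0 ?powR_ge0 // => v vy.
  have : (degree G v)%:R < 1 :> R by apply: le_lt_trans vy yk.
  by rewrite (ltr_nat R _ 1) ltnS leqn0 => /eqP->; rewrite powR0 ?gt_eqF.
have y2 : 0 < y / 2 by rewrite divr_gt0.
have := IH (y / 2) y2; rewrite ltr_pdivrMr // -exprSr => /(_ yk) {}IH.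
rewrite (bigID (fun v => (degree G v)%:R <= y / 2)) /=.
rewrite [X in _ <= X](_ : _ =
   K * #|T|%:R `^ q * (y / 2) `^ (p - q) + B * #|T|%:R `^ q * y `^ (p - q));
  last by rewrite powRM ?ltW // -/c -{1}KE; ring.
apply: lerD.
  rewrite (eq_bigl (fun v => (degree G v)%:R <= y / 2)) // => v.
  by rewrite andb_idl // => /le_trans; apply; lra.
apply: (@le_trans _ _ (\sum_(v in [set v | y / 2 <= (degree G v)%:R]) y `^ p)).
  rewrite [leRHS](bigID (fun v =>
    ((degree G v)%:R <= y) && ~~ ((degree G v)%:R <= y / 2))) /=.
  rewrite ler_wpDr ?sumr_ge0 // => [v _|]; first exact: powR_ge0.
  rewrite [leRHS](eq_bigl (fun v =>
    ((degree G v)%:R <= y) && ~~ ((degree G v)%:R <= y / 2))).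
    by apply: ler_sum => v /andP[vy _]; rewrite powR_le // ltW.
  by move=> v; rewrite inE andb_idl // => /andP[_]; rewrite -ltNge => /ltW.
rewrite sumr_const -[leLHS]mulr_natl.
have := ler_wpM2r (powR_ge0 y p) (HA T G _ freeG y2).
move=> /le_trans; apply; rewrite /B.
have -> : #|T|%:R / (y / 2) = 2 * #|T|%:R * y^-1 by field; rewrite gt_eqF.
rewrite !powRM ?mulr_ge0 ?invr_ge0 ?(ltW y0) //.
have yi : y^-1 `^ q * y `^ p = y `^ (p - q).
  by rewrite powRDp // powRN -[y^-1]powR_inv1 ?(ltW y0) // -powRrM mulN1r powRN mulrC.
by rewrite -yi le_eqVlt; apply/orP; left; apply/eqP; ring.
Qed.

Lemma small_powR (R : realType) (r c : R) : 0 < r -> 0 < c ->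
  exists2 e : R, 0 < e < 1 & e `^ r <= c.
Proof.
move=> r0 c0; pose m := Num.min 2^-1 (c `^ r^-1).
have m0 : 0 < m by rewrite lt_min invr_gt0 ltr0n powR_gt0.
exists m; first by rewrite m0 gt_min; apply/orP; left; lra.
have -> : c = (c `^ r^-1) `^ r by rewrite -powRrM mulVf ?gt_eqF // powRr1 // ltW.
by apply: powR_le; [exact: ltW | exact: ltW | rewrite ge_min lexx orbT].
Qed.

Lemma degree_ler_card (R : realType) (T : finType) (G : sgraph T) v :
  (degree G v)%:R <= #|T|%:R :> R.
Proof. by rewrite ler_nat degree_leq. Qed.

(* Vertices of degree at most e n contribute little; the others are boundedly
   many, so their degrees add up to at most s n + O(1), and those of degree
   below (1 - d) n satisfy deg^p <= (1 - d)^(p-1) n^(p-1) deg.  With fewer than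
   s vertices above (1 - d) n, a constant fraction of n^p would be lost. *)
Lemma large_degrees (R : realType) (Fs : graph_family) (q p A K d : R) (s b : nat) :
  0 < q -> q < p -> 1 < p -> 0 <= A -> 0 <= K -> 0 < d < 1 -> (0 < s)%N ->
  (forall (T : finType) (G : sgraph T) (x : R), family_free Fs G -> 0 < x ->
    #|[set v | x <= (degree G v)%:R]|%:R <= A * (#|T|%:R / x) `^ q) ->
  (forall (T : finType) (G : sgraph T) (y : R), family_free Fs G -> 0 < y ->
    \sum_(v | (degree G v)%:R <= y) (degree G v)%:R `^ p
      <= K * #|T|%:R `^ q * y `^ (p - q)) ->
  (forall (T : finType) (G : sgraph T) (S : {set T}), family_free Fs G ->
    (s < #|S|)%N -> (#|common_nbrs G S| <= b)%N) ->
  exists N : nat, forall (T : finType) (G : sgraph T), (N <= #|T|)%N ->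
    family_free Fs G -> s%:R * (#|T| - s)%:R `^ p <= degree_power p G ->
    (s <= #|[set v | ((1 - d) * #|T|%:R <= (degree G v)%:R)%R]|)%N.
Proof.
move=> q0 qp p1 A0 K0 /andP[d0 d1] s0 HA HK Hb.
have p0 : 0 < p by lra.
have sR : 1 <= s%:R :> R by rewrite ler1n.
(* The proportion lost by a vertex of degree below (1-d) n: its deg^(p-1) is at most (1-k)
   n^(p-1). *)
pose k : R := 1 - (1 - d) `^ (p - 1).
have k0 : 0 < k by rewrite subr_gt0 powR_lt1 //; lra.
have k1 : k <= 1 by rewrite gerBl powR_ge0.
have [e /andP[e0 e1] eK] : exists2 e : R, 0 < e < 1 & K * e `^ (p - q) <= k / 4.
  have [||e e01 He] := @small_powR _ (p - q) (k / 4 / (K + 1)); first by lra.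
    by rewrite !divr_gt0 //; lra.
  exists e => //; have : e `^ (p - q) * (K + 1) <= k / 4.
    by rewrite -ler_pdivlMr //; lra.
  by have := powR_ge0 e (p - q); lra.
(* [M] bounds the number of vertices of degree above e n, and [c0] the resulting error term in
   [sum_degree_high]. *)
pose M := Num.truncn (A * e^-1 `^ q).
pose c0 := (M * (2 ^ M * b))%N.
have ks : 0 < k / (4 * s%:R) < 1.
  apply/andP; split; first by rewrite divr_gt0 //; lra.
  by rewrite ltr_pdivrMr; lra.
(* Chosen so that (n-s)^p >= (1 - k/(4s)) n^p as soon as n-s >= eta n. *)
pose eta := (1 - k / (4 * s%:R)) `^ p^-1.
have eta1 : eta < 1 by apply: powR_lt1; rewrite ?invr_gt0 //; lra.
have eta0 : 0 <= eta by apply: powR_ge0.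
have etap : eta `^ p = 1 - k / (4 * s%:R).
  by rewrite /eta -powRrM mulVf ?gt_eqF // powRr1 //; lra.
exists (maxn s.+1 (maxn (Num.truncn (s%:R / (1 - eta))).+1
                        (Num.truncn (4 * c0%:R / k)).+1)).
move=> T G; rewrite !geq_max => /and3P[sT N1 N2] freeG lowb.
set n : R := #|T|%:R in lowb *.
have n0 : 0 < n by rewrite ltr0n (leq_trans _ sT).
have sn : s%:R <= (1 - eta) * n.
  rewrite mulrC -ler_pdivrMr ?subr_gt0 //.
  apply/ltW/(lt_le_trans (truncnS_gt _)); by rewrite ler_nat.
have cn : c0%:R <= k / 4 * n.
  have : 4 * c0%:R / k <= n.
    apply/ltW/(lt_le_trans (truncnS_gt _)); by rewrite ler_nat.
  by rewrite ler_pdivrMr //; lra.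
rewrite leqNgt; apply/negP; set S0 := [set v | _] => S0s.
pose P := n `^ (p - 1).
have P0 : 0 < P by rewrite powR_gt0.
have nP : n * P = n `^ p by rewrite mulr_powRB1 // ltW.
pose H := [set v | e * n < (degree G v)%:R].
have en : 0 < e * n by rewrite mulr_gt0.
have cH : (#|H| <= M)%N.
  have : (#|H| <= #|[set v | (e * n <= (degree G v)%:R)%R]|)%N.
    by apply/subset_leq_card/subsetP => v; rewrite !inE => /ltW.
  move=> /leq_trans; apply; rewrite truncn_ge_nat ?mulr_ge0 ?powR_ge0 //.
  apply: le_trans (HA T G _ freeG en) _; rewrite ler_wpM2l //.
  by rewrite (_ : n / (e * n) = e^-1) //; field; rewrite !gt_eqF.
have DH : \sum_(v in H) (degree G v)%:R <= s%:R * n + c0%:R :> R.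
  rewrite -natr_sum -natrM -natrD ler_nat.
  apply: leq_trans (sum_degree_high H (fun S => Hb T G S freeG)) _.
  by rewrite leq_add2l leq_mul // leq_mul2r leq_exp2l // cH orbT.
(* One bound for both kinds of vertices: those of [S0] receive the extra [k * n] that restores the
   full n^(p-1) deg. *)
have vP v : (degree G v)%:R `^ p <=
    P * ((1 - k) * (degree G v)%:R + k * (if v \in S0 then n else 0)).
  have dv0 : 0 <= (degree G v)%:R :> R by [].
  have dn := degree_ler_card R G v.
  rewrite -mulr_powRB1 //; case: ifPn => [_|].
    have : (degree G v)%:R `^ (p - 1) <= P by apply: powR_le => //; lra.
    move=> H1; apply: (@le_trans _ _ ((degree G v)%:R * P)).
      by rewrite ler_wpM2l.
    rewrite mulrC ler_pM2l //; have := ler_wpM2l (ltW k0) dn; rewrite -/n; lra.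
  rewrite inE -ltNge mulr0 addr0 => dlt.
  have : (degree G v)%:R `^ (p - 1) <= (1 - k) * P.
    rewrite subKr /P -powRM ?(ltW n0) //; last by lra.
    by apply: powR_le => //; [lra | exact: ltW].
  by move=> H1; have := ler_wpM2l dv0 H1; lra.
have low : \sum_(v | v \notin H) (degree G v)%:R `^ p <= k / 4 * (n * P).
  rewrite (eq_bigl (fun v => (degree G v)%:R <= e * n)); last first.
    by move=> v; rewrite inE -leNgt.
  apply: le_trans (HK T G _ freeG en) _; rewrite -/n powRM ?(ltW n0) ?(ltW e0) //.
  rewrite nP (_ : n `^ p = n `^ q * n `^ (p - q)); last first.
    by rewrite -powRDp // addrC subrK.
  have := ler_wpM2r (mulr_ge0 (powR_ge0 n q) (powR_ge0 n (p - q))) eK; lra.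
have high : \sum_(v in H) (degree G v)%:R `^ p <=
    P * ((1 - k) * (s%:R * n + c0%:R) + k * ((s%:R - 1) * n)).
  apply: le_trans (ler_sum _ (fun v _ => vP v)) _.
  rewrite -big_distrr /= ler_pM2l // big_split /= -!big_distrr /=.
  apply: lerD; first by rewrite ler_wpM2l // subr_ge0.
  rewrite ler_pM2l // -big_mkcondr /= sumr_const -[leLHS]mulr_natl.
  rewrite ler_pM2r // lerBrDr natr1 ler_nat; apply: leq_trans S0s.
  by rewrite ltnS; apply/subset_leq_card/subsetP => v /andP[].
have := lowb; rewrite /degree_power (bigID (fun v => v \in H)) /=.
apply/negP; rewrite -ltNge; apply: le_lt_trans (lerD high low) _.
have etan : eta * n <= (#|T| - s)%:R.
  by rewrite natrB ?(ltnW sT) // -/n; lra.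
have : eta `^ p * (n * P) <= (#|T| - s)%:R `^ p.
  by rewrite nP -powRM ?(ltW n0) // powR_le ?mulr_ge0 // ltW.
rewrite etap => /(ler_wpM2l (ler0n R s)); apply: lt_le_trans.
have -> : s%:R * ((1 - k / (4 * s%:R)) * (n * P)) = (s%:R - k / 4) * n * P.
  by field; rewrite gt_eqF //; lra.
(* Budget in units of n^p: the main terms give s - k, and the two errors at most k/4 each, so the
   total s - k/2 is below the required s - k/4. *)
rewrite [ltLHS](_ : _ =
    ((1 - k) * (s%:R * n + c0%:R) + k * ((s%:R - 1) * n) + k / 4 * n) * P);
  last by ring.
rewrite ltr_pM2r //.
have kc : (1 - k) * c0%:R <= k / 4 * n.
  apply: le_trans cn; rewrite ler_piMl //; lra.
have kn : 0 < k * n by rewrite mulr_gt0.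
lra.
Qed.

(** * Comparison with K_{s,n-s} *)

Lemma degree_power_Kbip (R : realType) (p : R) a b :
  degree_power p (Kbip a b) = a%:R * b%:R `^ p + b%:R * a%:R `^ p.
Proof.
have D x : degree (Kbip a b) x = if x is inl _ then b else a.
  rewrite degree_inT degree_inE big_mkcond /= big_sumType /=.
  under eq_bigr do rewrite inE adj_Kbip.
  under [X in (_ + X)%N]eq_bigr do rewrite inE adj_Kbip.
  by case: x => i; rewrite /= !sum_nat_const !card_ord !(muln0, muln1, addn0).
rewrite /degree_power big_sumType /=.
under eq_bigr do rewrite D; under [X in _ + X]eq_bigr do rewrite D.
by rewrite !sumr_const !card_ord !mulr_natl.
Qed.

(** For y >= 1 one has c + y <= (c+1) y. The coefficient 1 of c^p matters: over [W] this term must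
    cancel against the power sum of K_{s,n-s}. *)
Lemma powR_add_nat (R : realType) (p : R) (c y : nat) : 0 < p ->
  (c + y)%:R `^ p <= c%:R `^ p + c.+1%:R `^ p * y%:R `^ p :> R.
Proof.
move=> p0; have [->|y0] := posnP y.
  by rewrite addn0 powR0 ?gt_eqF // mulr0 addr0.
rewrite ler_wpDl ?powR_ge0 // -powRM // -natrM powR_le ?(ltW p0) // ler_nat.
by rewrite mulSn addnC leq_add2l leq_pmulr.
Qed.

(** Every vertex of [X] outside the common neighbourhood misses at least one vertex of [S]. *)
Lemma sum_degree_in_missed (T : finType) (G : sgraph T) (S X : {set T}) :
  (\sum_(u in S) degree_in G u X + #|X :\: common_nbrs G S| <= #|S| * #|X|)%N.
Proof.
rewrite degree_in_exchange -[X in (_ + X)%N]sum1_card.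
rewrite [X in (_ + X)%N](eq_bigl (fun w =>
    (w \in X) && (w \notin common_nbrs G S))); last first.
  by move=> w; rewrite in_setD andbC.
rewrite big_mkcondr -big_split /= mulnC -sum_nat_const.
apply: leq_sum => w _; case: ifPn => [nw|_].
  rewrite addn1; apply/proper_card/properP; split.
    by apply/subsetP => v; rewrite inE => /andP[].
  move: nw; rewrite inE negb_forall_in => /exists_inP[v vS nvw].
  by exists v => //; rewrite inE vS adj_sym.
by rewrite addn0 degree_in_card.
Qed.

(* Compared with K_{s,n-s}, each vertex of L costs at least (n-s)^(p-1) in the
   power sum over S, while the gain elsewhere comes only from the edges that
   touch L: those inside L are controlled by K, those between L and W number
   at most b #|L|. *)
Lemma exceptional_set_bound (R : realType) (p K : R) (T : finType) (G : sgraph T)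
    (S : {set T}) (s b : nat) :
  let W := common_nbrs G S in
  let L := ~: (S :|: W) in
  let N : R := (#|T| - s)%:R in
  1 < p -> 0 <= K -> #|S| = s ->
  (forall x y, x \in S :|: W -> y \in S :|: W -> adj G x y ->
    (x \in S) != (y \in S)) ->
  (forall S' : {set T}, (s < #|S'|)%N -> (#|common_nbrs G S'| <= b)%N) ->
  \sum_(v in L) (degree_in G v L)%:R `^ p <= K * #|L|%:R `^ p ->
  s%:R * N `^ p + N * s%:R `^ p <= degree_power p G ->
  #|L|%:R * N `^ (p - 1) <=
    (s.+1%:R `^ p * b%:R + (s + b)%:R `^ p + (s + b).+1%:R `^ p * K) *
    (#|L|%:R + #|L|%:R `^ p).
Proof.
move=> W L N p1 K0 cS sides Hb HL lowb.
have p0 : 0 < p by lra.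
have p10 : 0 <= p - 1 by lra.
have WS w : w \in W -> w \notin S by apply: common_nbrs_notin.
have cSC : (#|~: S| = #|T| - s)%N by rewrite -cS -(cardsC S) addKn.
have N0 : 0 <= N by [].
have LS v : v \in L -> v \notin S by rewrite in_setC in_setU negb_or => /andP[].
have LW v : v \in L -> v \notin W by rewrite in_setC in_setU negb_or => /andP[].
have split3 v : (degree G v = degree_in G v S + degree_in G v W + degree_in G v L)%N.
  rewrite degree_inT (degree_in_setID G v _ (S :|: W)) setTI setTD -/L.
  rewrite (degree_in_setID G v (S :|: W) S); congr (_ + _ + _)%N.
    by congr degree_in; rewrite setIUl setIid; apply/setUidPl/subsetIr.
  congr degree_in; rewrite setDUl setDv set0U; apply/setDidPl.
  by rewrite disjoints_subset; apply/subsetP => w /WS; rewrite inE.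
(* Used with [c] true for [S] and false for [W]: both sets are independent. *)
have inside0 (X : {set T}) v (c : bool) :
    X \subset S :|: W -> (forall w, w \in X -> (w \in S) = c) -> v \in X ->
    degree_in G v X = 0%N.
  move=> XSW Xc vX; rewrite degree_inE big1 // => w wX; apply/eqP; rewrite eqb0.
  apply/negP => vw.
  have := sides v w (subsetP XSW _ vX) (subsetP XSW _ wX) vw.
  by rewrite !Xc ?eqxx.
have degS u : u \in S -> degree G u = degree_in G u (~: S).
  move=> uS; rewrite degree_inT (degree_in_setID G u _ S) setTI setTD.
  by rewrite (inside0 S u true) ?add0n // subsetUl.
have sumS : (\sum_(u in S) degree G u + #|L| <= s * (#|T| - s))%N.
  rewrite (eq_bigr _ degS) -cSC -cS.
  have -> : L = ~: S :\: W by rewrite /L setCU setDE.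
  exact: sum_degree_in_missed.
have degW w : w \in W -> (degree G w <= s + degree_in G w L)%N.
  move=> wW; rewrite split3 (inside0 W w false) ?subsetUr //; last first.
    by move=> x /WS/negbTE.
  by rewrite addn0 leq_add2r -cS degree_in_card.
(* The neighbours of [v] in [W] are common neighbours of [v |: S], a set of s + 1 vertices. *)
have degLW v : v \in L -> (degree_in G v W <= b)%N.
  move=> vL; apply: leq_trans (Hb (v |: S) _); last by rewrite cardsU1 LS // cS.
  apply/subset_leq_card/subsetP => w; rewrite !inE => /andP[/forall_inP wW vw].
  by apply/forall_inP => u; rewrite !inE => /orP[/eqP->|/wW].
have degL v : v \in L -> (degree G v <= (s + b) + degree_in G v L)%N.
  by move=> vL; rewrite split3 leq_add2r leq_add ?degLW // -cS degree_in_card.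
have sumWL : (\sum_(w in W) degree_in G w L <= #|L| * b)%N.
  by rewrite degree_in_exchange -sum_nat_const; apply: leq_sum => v /degLW.
have partS : \sum_(u in S) (degree G u)%:R `^ p <=
    N `^ (p - 1) * (s%:R * N - #|L|%:R).
  apply: (@le_trans _ _ (N `^ (p - 1) * (\sum_(u in S) degree G u)%:R)).
    rewrite natr_sum big_distrr /=; apply: ler_sum => u uS.
    rewrite -mulr_powRB1 // mulrC ler_wpM2r // powR_le //.
    by rewrite ler_nat degS // -cSC degree_in_card.
  by rewrite ler_wpM2l ?powR_ge0 // lerBrDr -natrM -natrD ler_nat.
have partW : \sum_(w in W) (degree G w)%:R `^ p <=
    N * s%:R `^ p + s.+1%:R `^ p * b%:R * #|L|%:R `^ p.
  apply: (@le_trans _ _ (\sum_(w in W)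
      (s%:R `^ p + s.+1%:R `^ p * (#|L|%:R `^ (p - 1) * (degree_in G w L)%:R)))).
    apply: ler_sum => w wW; apply: (@le_trans _ _ ((s + degree_in G w L)%:R `^ p)).
      by rewrite powR_le ?(ltW p0) // ler_nat degW.
    apply: le_trans (powR_add_nat _ _ p0) _; rewrite lerD2l ler_wpM2l ?powR_ge0 //.
    rewrite -mulr_powRB1 // mulrC ler_wpM2r // powR_le // ler_nat.
    exact: degree_in_card.
  rewrite big_split /= -!big_distrr /= sumr_const -[X in X + _]mulr_natl.
  apply: lerD.
    rewrite ler_wpM2r ?powR_ge0 // ler_nat -cSC; apply/subset_leq_card/subsetP.
    by move=> w /WS; rewrite inE.
  rewrite -mulrA ler_wpM2l ?powR_ge0 // -natr_sum.
  rewrite -(mulr_powRB1 _ p0) // mulrA mulrC ler_wpM2r ?powR_ge0 //.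
  by rewrite -natrM ler_nat mulnC.
have partL : \sum_(v in L) (degree G v)%:R `^ p <=
    (s + b)%:R `^ p * #|L|%:R + (s + b).+1%:R `^ p * K * #|L|%:R `^ p.
  apply: (@le_trans _ _ (\sum_(v in L)
      ((s + b)%:R `^ p + (s + b).+1%:R `^ p * (degree_in G v L)%:R `^ p))).
    apply: ler_sum => v vL; apply: le_trans (powR_add_nat _ _ p0).
    by rewrite powR_le ?(ltW p0) // ler_nat degL.
  rewrite big_split /= -big_distrr /= sumr_const -[X in X + _]mulr_natr lerD2l.
  by rewrite -mulrA ler_wpM2l ?powR_ge0.
have total : degree_power p G = \sum_(u in S) (degree G u)%:R `^ p +
    \sum_(w in W) (degree G w)%:R `^ p + \sum_(v in L) (degree G v)%:R `^ p.
  rewrite /degree_power (bigID (fun v => v \in S :|: W)) /=; congr (_ + _); last first.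
    by apply: eq_bigl => v; rewrite in_setC.
  rewrite (bigID (fun v => v \in S)) /=; congr (_ + _); apply: eq_bigl => v.
    by rewrite in_setU; case: (v \in S); rewrite ?andbF.
  by rewrite in_setU; case: (boolP (v \in W)) => [/WS->|_]; rewrite ?orbT ?orbF ?andbN.
have NN : N `^ (p - 1) * N = N `^ p by rewrite mulrC mulr_powRB1.
have l0 : 0 <= #|L|%:R :> R by [].
have lp0 : 0 <= #|L|%:R `^ p :> R by apply: powR_ge0.
have c1 : 0 <= s.+1%:R `^ p * b%:R :> R by rewrite mulr_ge0 ?powR_ge0.
have c2 : 0 <= (s + b)%:R `^ p :> R by apply: powR_ge0.
have c3 : 0 <= (s + b).+1%:R `^ p * K :> R by rewrite mulr_ge0 ?powR_ge0.
move: partS; rewrite mulrBr mulrCA NN => partS.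
have := lerD (lerD partS partW) partL; rewrite -total => /(le_trans lowb).
(* These nonnegative cross terms complete the right-hand side to a product with |L| + |L|^p. *)
have := mulr_ge0 c1 l0; have := mulr_ge0 c2 lp0; have := mulr_ge0 c3 l0.
by rewrite !mulrDl !mulrDr; lra.
Qed.

Lemma spanning_Kbip (R : realType) (Fs : graph_family) (a C p : R) (s : nat) :
  0 <= a < 1 -> 0 < C -> (1 - a)^-1 < p -> (0 < s)%N -> tau_family Fs = s.+1 ->
  (forall n, (0 < n)%N -> (extremal n Fs)%:R <= C * n%:R `^ (1 + a)) ->
  exists n0 : nat, forall (T : finType) (G : sgraph T), (n0 <= #|T|)%N ->
    family_free Fs G -> maximal_free Fs (Kbip s (#|T| - s)) ->
    degree_power p (Kbip s (#|T| - s)) <= degree_power p G ->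
    isomorphic G (Kbip s (#|T| - s)).
Proof.
move=> a01 C0 qp s0 tauE exC; have /andP[a0 a1] := a01.
set q := (1 - a)^-1 in qp.
have q1 : 1 <= q by rewrite invf_ge1; lra.
have [p1 q0] : 1 < p /\ 0 < q by split; lra.
have p0 : 0 < p by lra.
have A0 : 0 <= (16 * C) `^ q by apply: powR_ge0.
have HA (T : finType) (G : sgraph T) (x : R) : family_free Fs G -> 0 < x ->
    #|[set v | x <= (degree G v)%:R]|%:R <= (16 * C) `^ q * (#|T|%:R / x) `^ q.
  move=> freeG x0; rewrite -powRM ?divr_ge0 ?(ltW x0) ?mulr_ge0 ?(ltW C0) //.
  by rewrite mulrA; apply: (high_degree_count a01 C0 exC).
have [K K0 HK] := low_degree_power A0 qp p0 HA.
have [|b Hb] := @common_nbrs_bounded Fs; first by rewrite tauE.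
rewrite tauE in Hb.
pose D := s.+1%:R `^ p * b%:R + (s + b)%:R `^ p + (s + b).+1%:R `^ p * K : R.
have D0 : 0 <= D by rewrite !addr_ge0 // ?mulr_ge0 // powR_ge0.
(* Chosen so that D e^(p-1) <= 1/2, where [D] is the constant of [exceptional_set_bound]. *)
have [||e /andP[e0 e1] eD] := @small_powR _ (p - 1) (2 * (D + 1))^-1; first by lra.
  by rewrite invr_gt0; lra.
have sR : 1 <= s%:R :> R by rewrite ler1n.
(* Each of the [s] large vertices misses at most d n vertices, so at most s d n = e n/2 vertices lie
   outside [W]. *)
pose d := e / (2 * s%:R).
have sd : s%:R * d = e / 2 by rewrite /d; field; rewrite gt_eqF //; lra.
have d01 : 0 < d < 1.
  apply/andP; split; first by rewrite divr_gt0 //; lra.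
  by rewrite ltr_pdivrMr; lra.
have [N HN] := large_degrees q0 qp p1 A0 K0 d01 s0 HA HK
  (fun T G S freeG => Hb T G S freeG).
(* The threshold beyond which m^(p-1) >= 2D + 1. *)
pose y := (2 * D + 1) `^ (p - 1)^-1.
have yp : y `^ (p - 1) = 2 * D + 1.
  by rewrite /y -powRrM mulVf ?powRr1 //; lra.
exists (maxn N (maxn (2 * s) (maxn (2 * (family_order Fs + 2)) (2 * (Num.truncn y).+1)))).
move=> T G; rewrite !geq_max => /and4P[NT sT foT yT] freeG maxK.
rewrite degree_power_Kbip => lowb.
have cT : #|T| = (s + (#|T| - s))%N by clear -sT; lia.
set m := (#|T| - s)%N in lowb maxK cT *.
have Tm : #|T|%:R <= 2 * m%:R :> R by rewrite -natrM ler_nat /m; clear -sT; lia.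
have mp : 2 * D + 1 <= m%:R `^ (p - 1).
  rewrite -yp powR_le ?powR_ge0 //; first by lra.
  apply/ltW/(lt_le_trans (truncnS_gt _)); rewrite ler_nat /m; clear -sT yT.
  by move: (Num.truncn y) yT => k; lia.
have [|S SS0 cS] := subset_of_card (HN T G NT freeG _).
  by apply: le_trans lowb; rewrite lerDl mulr_ge0 ?powR_ge0.
set W := common_nbrs G S.
have cW : #|~: W|%:R <= e / 2 * #|T|%:R :> R.
  have := sum_degree_in_missed G S [set: T]; rewrite -/W setTD cS cardsT.
  rewrite -(ler_nat R) natrD natrM natr_sum.
  have : s%:R * ((1 - d) * #|T|%:R) <= \sum_(u in S) (degree_in G u [set: T])%:R :> R.
    rewrite -cS mulr_natl -sumr_const; apply: ler_sum => u uS.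
    by have := subsetP SS0 _ uS; rewrite inE -degree_inT.
  by rewrite mulrA mulrBr sd; lra.
have cW2 : (family_order Fs + 2 <= #|W|)%N.
  have : 2 * #|~: W|%:R <= #|T|%:R :> R.
    have := ler_wpM2r (ler0n R #|T|) (ltW e1); lra.
  rewrite -natrM ler_nat; have := cardsC W; clear -foT; lia.
have sides x z := @maximal_Kbip_sides _ _ G S _ _ x z maxK freeG cS cT cW2.
pose L := ~: (S :|: W).
have HL : \sum_(v in L) (degree_in G v L)%:R `^ p <= K * #|L|%:R `^ p.
  have [/cards0_eq->|l0] := posnP #|L|.
    by rewrite big_set0 mulr_ge0 ?powR_ge0.
  rewrite degree_power_in.
  have lR : 0 < #|L|%:R :> R by rewrite ltr0n.
  (* With y = |L| the degree restriction holds for every vertex of the graph induced on [L], and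
     |L|^q |L|^(p-q) = |L|^p. *)
  have := HK _ _ _ (induced_free L freeG) lR.
  rewrite card_ord -mulrA -powRDp // addrC subrK; apply: le_trans.
  rewrite /degree_power [leRHS](eq_bigl xpredT) // => v.
  by have := degree_ler_card R (induced_graph G L) v; rewrite card_ord.
have := exceptional_set_bound p1 K0 cS sides (Hb T G ^~ freeG) HL lowb.
rewrite -/L -/m -/D => bound.
(* Otherwise dividing [bound] by |L| gives m^(p-1) <= D (1 + |L|^(p-1)). As |L| <= e m, the right
   side is at most D + m^(p-1)/2, contradicting m^(p-1) >= 2D + 1. *)
have L0 : L = set0.
  apply/eqP; rewrite -cards_eq0 -leqn0 leqNgt; apply/negP => l0.
  have lR : 0 < #|L|%:R :> R by rewrite ltr0n.
  move: bound; rewrite -(mulr_powRB1 (ltW lR) p0).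
  rewrite [leRHS](_ : _ = #|L|%:R * (D * (1 + #|L|%:R `^ (p - 1)))); last by ring.
  rewrite ler_pM2l //; apply/negP; rewrite -ltNge.
  have lm : #|L|%:R <= e * m%:R :> R.
    have : #|L|%:R <= #|~: W|%:R :> R.
      by rewrite ler_nat; apply/subset_leq_card; rewrite setCS subsetUr.
    have := ler_wpM2l (ltW e0) Tm; lra.
  have : #|L|%:R `^ (p - 1) <= e `^ (p - 1) * m%:R `^ (p - 1).
    by rewrite -powRM ?(ltW e0) // powR_le //; lra.
  have mp0 : 0 <= m%:R `^ (p - 1) :> R by apply: powR_ge0.
  move=> /(ler_wpM2l D0).
  have De : D * e `^ (p - 1) <= 1 / 2.
    apply: le_trans (ler_wpM2l D0 eD) _.
    by rewrite ler_pdivrMr; lra.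
  have := ler_wpM2r mp0 De; lra.
have SW v : (v \in W) = (v \notin S).
  apply/idP/idP => [|vS]; first exact: common_nbrs_notin.
  by have := in_set0 v; rewrite -L0 in_setC in_setU (negbTE vS) => /negbFE.
apply: (Kbip_iso cS cT) => x z.
apply/idP/idP => [|xz]; first by apply: sides; rewrite in_setU SW orbN.
case xS: (x \in S) xz; case zS: (z \in S) => //= _.
  by have /common_nbrsP : z \in W; [rewrite SW zS | apply].
by rewrite adj_sym; have /common_nbrsP : x \in W; [rewrite SW xS | apply].
Qed.

Local Open Scope classical_set_scope.

Theorem corollary1p4 (R : realType) (Fs : graph_family) (alpha p : R)
    (hdeg : degenerate Fs)
    (halpha : 0 <= alpha < 1)
    (hex : (fun n : nat => (extremal n Fs)%:R : R^o)
             =O_\oo (fun n : nat => n%:R `^ (1 + alpha) : R^o))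
    (htau : (2 <= tau_family Fs)%N)
    (hp : 1 / (1 - alpha) < p) :
  exists n0 : nat, forall n : nat, (n0 <= n)%N ->
    forall (T : finType) (G : sgraph T),
      #|T| = n ->
      family_free Fs G ->
      degree_power p G = extremal_p p n Fs ->
      maximal_free Fs (Kbip (tau_family Fs - 1) (n - tau_family Fs + 1)) ->
      isomorphic G (Kbip (tau_family Fs - 1) (n - tau_family Fs + 1)).
Proof.
have [|C C0 exC] := extremal_bigO hex; first by lra.
have tE : tau_family Fs = (tau_family Fs - 1).+1 by lia.
have s0 : (0 < tau_family Fs - 1)%N by lia.
rewrite div1r in hp; have [n0 Hn0] := spanning_Kbip halpha C0 hp s0 tE exC.
(* Requiring [tau_family Fs <= n] keeps the truncated subtraction exact. *)
exists (maxn n0 (tau_family Fs)) => n; rewrite geq_max => /andP[nn0 nt] T G cT.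
have -> : (n - tau_family Fs + 1 = #|T| - (tau_family Fs - 1))%N by lia.
move=> freeG extG maxK; apply: (Hn0 _ _ _ freeG maxK); first by rewrite cT.
(* K_{s,n-s} is itself free, being maximal, so its power sum is at most the extremal value attained
   by [G]. *)
rewrite extG -cT.
have /andP[freeK _] := maxK; have := degree_power_extremal_p p freeK.
by rewrite card_sum !card_ord; congr (_ <= extremal_p p _ Fs); lia.
Qed.
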